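(* Let $S$ be a finite collection of codimension $1$ polyhedral cones in $\mathbb{R}^n$ such that $T:=\bigcup_{C\in S}C$ is the support of a tropical hypersurface, and let $\omega\in\mathbb{R}^n\setminus T$. Then the procedure $\mathrm{Region}(S,\omega)$ described in the context outputs the (open) connected component of $\mathbb{R}^n\setminus T$ containing $\omega$.
   Context: The tropical hypersurface of a polytope $P\subset\mathbb{R}^n$ is the set of $\omega\in\mathbb{R}^n$ for which there exist distinct $p,q\in P$ with $\omega\cdot p=\omega\cdot q\le\omega\cdot r$ for all $r\in P$; a set is the support of a tropical hypersurface if it is the tropical hypersurface of some polytope. The cones in $S$ may overlap arbitrarily and need not form a fan. Procedure $\mathrm{Region}(S,\omega)$: Set $R:=\mathbb{R}^n$. For each $C\in S$: while $R\cap C\neq\emptyset$ do the following. (i) Find a point $p\in R\cap C$. (ii) Introduce a parameter $\varepsilon>0$ and let $h$ be the open half line from $\omega$ through $p+\sum_{i=1}^n\varepsilon^ie_i$ (starting at $\omega$ and unbounded). The set of cones in $S$ that intersect $h$, and the ordering of the intersection points along $h$, are the same for all sufficiently small $\varepsilon>0$. (iii) Among the cones in $S$ that intersect $h$ (for sufficiently small $\varepsilon>0$), let $D$ be one whose intersection point is closest to $\omega$ (any choice if not unique). (iv) Let $H\subset\mathbb{R}^n$ be the open half space that is the connected component of $\mathbb{R}^n\setminus\mathrm{span}(D)$ containing $\omega$, and replace $R$ by $R\cap H$. After all $C\in S$ have been processed, return $R$. *)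

(* Defs.v *)
From HB Require Import structures.
From Stdlib Require Export Relation_Operators.
From mathcomp Require Export all_boot all_order all_algebra.
From mathcomp Require Export all_classical all_reals all_analysis.

Set Implicit Arguments.
Unset Strict Implicit.
Unset Printing Implicit Defensive.

Import Order.TTheory GRing.Theory Num.Theory.
Import numFieldNormedType.Exports.

Local Open Scope classical_set_scope.
Local Open Scope ring_scope.

Section Geometry.
Context {R : realType} {n : nat}.
Local Notation V := 'rV[R]_n.
Implicit Types (x y w p : V) (A C P : set V).

Definition dot x y : R := \sum_(i < n) x 0 i * y 0 i.

(* The norm on 'rV[R]_n in the library is the max norm, hence this one. *)
Definition edist x y : R := Num.sqrt (dot (x - y) (x - y)).

Definition convex_hull m (v : 'I_m -> V) : set V :=
  [set x | exists c : 'I_m -> R,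
     [/\ forall i, 0 <= c i, \sum_i c i = 1 & x = \sum_i c i *: v i]].

Definition polytope P : Prop := exists m (v : 'I_m -> V), P = convex_hull v.

Definition tropical_hypersurface P : set V :=
  [set w | exists p q, [/\ P p, P q, p <> q, dot w p = dot w q
                         & forall r, P r -> dot w q <= dot w r]].

Definition is_tropical_hypersurface A : Prop :=
  exists P, polytope P /\ A = tropical_hypersurface P.

Definition polyhedral_cone C : Prop :=
  exists m (a : 'I_m -> V), C = [set x | forall i, 0 <= dot (a i) x].

(* Linear span of a possibly infinite set: the vectors in the span of some
   finite list of its elements. *)
Definition lspan A : set V :=
  [set x | exists s : seq V, (forall y, y \in s -> A y) /\ x \in span s].

(* The dimension of a cone is the dimension of its linear span. *)
Definition codim1 C : Prop :=
  exists U : {vspace V}, lspan C = [set` U] /\ (\dim U).+1 = n.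

Definition half_line w x : set V := [set w + t *: (x - w) | t in [set t | 0 < t]].

(* The vector e_i of the standard basis, 1 <= i <= n, has index i - 1 here. *)
Definition perturb p (e : R) : V := p + \sum_(i < n) e ^+ i.+1 *: delta_mx 0 i.

Definition cone_union (S : seq (set V)) : set V := \bigcup_(C in [set` S]) C.

Section Procedure.
Variables (S : seq (set V)) (w : V).
Implicit Types (h Q D : set V) (s : seq (set V)).

Definition closest_on h D : Prop :=
  exists q, D `&` h = [set q] /\
    forall C q', C \in S -> (C `&` h) q' -> edist w q <= edist w q'.

Definition selectable p D : Prop :=
  D \in S /\ \forall e \near 0^'+, closest_on (half_line w (perturb p e)) D.

(* In each state, s lists the cones still to be processed, starting with the
   current one, and Q is the current region.  The point p and the cone D are
   chosen by separate transitions, so that a choice of p after which no D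
   could be selected would show up as a stuck state. *)
Inductive state :=
| AtTest s Q
| PointFound s Q of V
| ConeSelected s Q of set V.

Inductive step : state -> state -> Prop :=
| step_next C s Q :
    Q `&` C = set0 -> step (AtTest (C :: s) Q) (AtTest s Q)
| step_point C s Q p :
    (Q `&` C) p -> step (AtTest (C :: s) Q) (PointFound (C :: s) Q p)
| step_select s Q p D :
    selectable p D -> step (PointFound s Q p) (ConeSelected s Q D)
| step_cut s Q D :
    ~ lspan D w ->
    step (ConeSelected s Q D)
         (AtTest s (Q `&` connected_component (~` lspan D) w)).

Definition initial : state := AtTest S setT.

Definition reachable (c : state) : Prop := clos_refl_trans_1n state step initial c.

(* Total correctness: whatever choices are made, the procedure halts, never
   gets stuck, and returns K.  The cones are processed in the order of the
   list S; other orders are obtained by permuting S. *)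
Definition region_outputs (K : set V) : Prop :=
  [/\ Acc (fun c' c => step c c') initial,
      forall c, reachable c ->
        (exists c', step c c') \/ (exists Q, c = AtTest [::] Q)
    & forall Q, reachable (AtTest [::] Q) -> Q = K].

End Procedure.
End Geometry.

(* Main.v *)
(** A point [w] off the tropical hypersurface of [P] minimizes a unique vertex of
    [P], so the component [K] of [w] is an open polyhedral cone, cut out by
    finitely many strict linear inequalities.

    Perturbation makes the ray avoid all proper faces of the cones it meets, so
    the first cone [D] it hits is met in a relative interior point [q], which
    lies in the closure of [K].  If [K] met [span D] at [x], points of the segment
    from [q] to [x] close to [q] would lie both in [D] and in [K].  Hence no cut
    removes a point of [K].

    If [p] is in [R] and in [C], then [p] is not in [K], and the ray leaves the
    closure of [K] arbitrarily soon after [p], hence before it leaves the open set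
    [R].  So the first hit lies in [R], and the cut strictly decreases the number
    of spans that meet [R]: the procedure halts.  At the end [R] is convex,
    contains [w] and misses all the cones, hence lies in [K]. *)

From HB Require Import structures.
Require Import Defs.
From mathcomp Require Import ring lra zify.
Import Order.TTheory GRing.Theory Num.Theory.
Import numFieldNormedType.Exports.
Local Open Scope classical_set_scope.
Local Open Scope ring_scope.
Set Implicit Arguments.
Unset Strict Implicit.
Unset Printing Implicit Defensive.

(** * Open polyhedral cones and connected components *)

Section DotProduct.
Context {R : realType} {n : nat}.
Local Notation V := 'rV[R]_n.
Implicit Types (a c p w x y : V) (s : seq V) (A : set V).

Lemma dotC x y : dot x y = dot y x.
Proof. by apply: eq_bigr => i _; rewrite mulrC. Qed.

Lemma dotDr a x y : dot a (x + y) = dot a x + dot a y.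
Proof.
by rewrite /dot -big_split; apply: eq_bigr => i _; rewrite mxE mulrDr.
Qed.

Lemma dotZr a t x : dot a (t *: x) = t * dot a x.
Proof.
by rewrite /dot mulr_sumr; apply: eq_bigr => i _; rewrite mxE mulrCA.
Qed.

Lemma dotNr a x : dot a (- x) = - dot a x.
Proof. by rewrite -scaleN1r dotZr mulN1r. Qed.

Lemma dotBr a x y : dot a (x - y) = dot a x - dot a y.
Proof. by rewrite dotDr dotNr. Qed.

Lemma dotDl x y a : dot (x + y) a = dot x a + dot y a.
Proof. by rewrite dotC dotDr !(dotC a). Qed.

Lemma dotZl t x a : dot (t *: x) a = t * dot x a.
Proof. by rewrite dotC dotZr dotC. Qed.

Lemma dotBl x y a : dot (x - y) a = dot x a - dot y a.
Proof. by rewrite dotC dotBr !(dotC a). Qed.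

Lemma dot0l x : dot 0 x = 0.
Proof. by rewrite -(scale0r x) dotZl mul0r. Qed.

Lemma dot0r x : dot x 0 = 0.
Proof. by rewrite dotC dot0l. Qed.

Lemma dot_sumr I (r : seq I) (F : I -> V) a :
  dot a (\sum_(i <- r) F i) = \sum_(i <- r) dot a (F i).
Proof. by apply: (big_morph (dot a)); [exact: dotDr | exact: dot0r]. Qed.

Lemma dot_delta a i : dot a (delta_mx 0 i) = a 0 i.
Proof.
rewrite /dot (bigD1 i) //= mxE !eqxx mulr1 big1 ?addr0 // => j ji.
by rewrite mxE (negbTE ji) andbF mulr0.
Qed.

Lemma dotxx_ge0 x : 0 <= dot x x.
Proof. by apply: sumr_ge0 => i _; rewrite -expr2 sqr_ge0. Qed.

Lemma dotxx_eq0 x : dot x x = 0 -> x = 0.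
Proof.
move=> x0; apply/rowP => i; rewrite mxE.
have x2_ge0 j : true -> 0 <= x 0 j * x 0 j by rewrite -expr2 sqr_ge0.
by have /eqP := psumr_eq0P x2_ge0 x0 (i := i) isT; rewrite mulf_eq0 orbb => /eqP.
Qed.

Lemma dotxx_gt0 x : x != 0 -> 0 < dot x x.
Proof.
move=> x0; rewrite lt_def dotxx_ge0 andbT.
by apply: contra_neq x0; apply: dotxx_eq0.
Qed.

Lemma dot_continuous a : continuous (dot a : V -> R).
Proof.
have -> : (dot a : V -> R) = \sum_(i < n) (fun x : V => a 0 i * x 0 i).
  by apply/funext => x; rewrite fct_sumE.
apply: (@big_ind _ (fun f : V -> R => continuous f)).
- exact: cst_continuous.
- by move=> f g cf cg x; apply: continuousD; [exact: cf | exact: cg].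
- move=> i _ x; apply: continuousM; first exact: cst_continuous.
  exact: coord_continuous.
Qed.

Definition open_halfspaces s : set V := [set x | forall a, a \in s -> 0 < dot a x].

Lemma open_halfspaces_cons a s :
  open_halfspaces (a :: s) = [set x | 0 < dot a x] `&` open_halfspaces s.
Proof.
apply/seteqP; split=> [x xs|x [/= xa xs] b].
  by split=> [|b bs]; apply: xs; rewrite inE ?eqxx ?bs ?orbT.
by rewrite inE => /orP[/eqP ->|/xs].
Qed.

Lemma open_halfspaces_cat s1 s2 :
  open_halfspaces (s1 ++ s2) = open_halfspaces s1 `&` open_halfspaces s2.
Proof.
elim: s1 => [|a s1 IH] /=; last by rewrite !open_halfspaces_cons IH setIA.
by rewrite (_ : open_halfspaces [::] = setT) ?setTI //; apply/seteqP; split.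
Qed.

Lemma open_open_halfspaces s : open (open_halfspaces s).
Proof.
elim: s => [|a s IH].
  rewrite (_ : open_halfspaces [::] = setT); first exact: openT.
  by apply/seteqP; split.
rewrite open_halfspaces_cons; apply: openI => //.
apply: (@open_comp _ _ (dot a : V -> R) [set r | 0 < r]); last exact: open_gt.
by move=> x _; apply: dot_continuous.
Qed.

Lemma closed_halfspaces s : closed [set x : V | forall a, a \in s -> 0 <= dot a x].
Proof.
rewrite (_ : [set x | _] =
  \bigcap_(a in [set` s]) ((dot a : V -> R) @^-1` [set r | 0 <= r])); last first.
  by apply/seteqP; split.
apply: closed_bigI => a _; apply: closed_comp; last exact: closed_ge.
by move=> x _; apply: dot_continuous.
Qed.

Lemma dot_segment a w x t :
  dot a (w + t *: (x - w)) = (1 - t) * dot a w + t * dot a x.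
Proof. by rewrite dotDr dotZr dotBr; ring. Qed.

Lemma open_halfspaces_segment s w x t : 0 <= t <= 1 ->
  open_halfspaces s w -> open_halfspaces s x ->
  open_halfspaces s (w + t *: (x - w)).
Proof.
move=> /andP[t0 t1] ws xs a sa; have := ws a sa; have := xs a sa.
rewrite dot_segment => xa wa; nra.
Qed.

Lemma segment_connected_component A w x :
  (forall t, 0 <= t <= 1 -> A (w + t *: (x - w))) -> connected_component A w x.
Proof.
move=> Ax; pose f (t : R) : V := w + t *: (x - w).
apply: (@connected_component_max _ A (f @` `[0, 1]) w).
- exists 0; first by rewrite /= in_itv /= lexx ler01.
  by rewrite /f scale0r addr0.
- by move=> _ [t /= t01 <-]; apply: Ax; rewrite in_itv in t01.
- apply: connected_continuous_connected; first exact: segment_connected.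
  apply: continuous_subspaceT => t; apply: cvgD; first exact: cvg_cst.
  by apply: cvgZr_tmp; exact: cvg_id.
- exists 1; first by rewrite /= in_itv /= lexx ler01.
  by rewrite /f scale1r addrC subrK.
Qed.

(** The last hypothesis says that, inside [A], the strict and the weak inequalities cut out the same
    points. The open polyhedron is then both open and closed relative to the component, and
    convexity gives the other inclusion. *)
Lemma connected_component_halfspaces A s w :
  open_halfspaces s w -> open_halfspaces s `<=` A ->
  (forall x, A x -> (forall a, a \in s -> 0 <= dot a x) -> open_halfspaces s x) ->
  connected_component A w = open_halfspaces s.
Proof.
move=> ws sA As; apply/seteqP; split; last first.
  move=> x xs; apply: segment_connected_component => t t01.
  by apply: sA; apply: open_halfspaces_segment.
set K := connected_component A w; suff <- : K `&` open_halfspaces s = K.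
  by move=> x [].
apply: (@component_connected _ A w).
- by exists w; split=> //; apply: connected_component_refl; apply: sA.
- by exists (open_halfspaces s) => //; apply: open_open_halfspaces.
- exists [set x | forall a, a \in s -> 0 <= dot a x].
    exact: closed_halfspaces.
  apply/seteqP; split=> x [Kx xs]; split=> //; first by move=> a /xs /ltW.
  by apply: As => //; apply: connected_component_sub Kx.
Qed.

End DotProduct.

(** * Signs of linear functionals along the perturbed rays *)

Section Perturbation.
Context {R : realType} {n : nat}.
Local Notation V := 'rV[R]_n.

Lemma near_seq_forall (T : eqType) (s : seq T) (P : T -> R -> Prop)
    (F : set_system R) {FF : Filter F} :
  (forall a, a \in s -> \forall e \near F, P a e) ->
  \forall e \near F, forall a, a \in s -> P a e.
Proof.
elim: s => [_|a s IH Ps]; first by near=> e.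
have Ns : \forall e \near F, forall b, b \in s -> P b e.
  by apply: IH => b bs; apply: Ps; rewrite inE bs orbT.
have Na : \forall e \near F, P a e by apply: Ps; rewrite inE eqxx.
near=> e => b; rewrite inE => /orP[/eqP ->|bs]; first by near: e.
by move: b bs; near: e.
Unshelve. all: by end_near. Qed.

Lemma near_right0_ex2 (P Q : R -> Prop) :
  (\forall e \near 0^'+, P e) -> (\forall e \near 0^'+, Q e) ->
  exists e, [/\ 0 < e, P e & Q e].
Proof.
move=> nP nQ; near (0 : R)^'+ => e; exists e; split; near: e => //.
exact: nbhs_right_gt.
Unshelve. all: by end_near. Qed.

Lemma poly_near0_gt0 (f : {poly R}) : 0 < f.[0] ->
  \forall e \near 0^'+, 0 < f.[e].
Proof.
move=> f0; apply: cvgr_gt f0.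
by apply: cvg_at_right_filter; exact: continuous_horner.
Qed.

(** Induction on [f * 'X + c%:P]: a nonzero constant term decides the sign near 0; otherwise the
    factor ['X] is positive to the right of 0 and the sign is that of [f]. *)
Lemma poly_near0_sign (f : {poly R}) : [\/ f = 0,
  \forall e \near 0^'+, 0 < f.[e] | \forall e \near 0^'+, f.[e] < 0].
Proof.
elim/poly_ind: f => [|f c IH]; first by constructor 1.
have neg (g : {poly R}) : g.[0] < 0 -> \forall e \near 0^'+, g.[e] < 0.
  rewrite -oppr_gt0 -hornerN => /poly_near0_gt0 g0.
  by near=> e; rewrite -oppr_gt0 -hornerN; near: e.
case: (ltgtP c 0) => [c0|c0|->].
- by constructor 3; apply: neg; rewrite hornerD hornerMX hornerC mulr0 add0r.
- constructor 2; apply: poly_near0_gt0.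
  by rewrite hornerD hornerMX hornerC mulr0 add0r.
rewrite addr0; case: IH => [->|f0|f0].
- by constructor 1; rewrite mul0r.
- constructor 2; near=> e; rewrite hornerMX pmulr_lgt0; first by near: e.
  by near: e; exact: nbhs_right_gt.
- constructor 3; near=> e; rewrite hornerMX nmulr_rlt0; last by near: e.
  by near: e; exact: nbhs_right_gt.
Unshelve. all: by end_near. Qed.

Variables (w p : V).
Local Notation d e := (perturb p e - w).

(** The value of [dot c] on the ray direction as a polynomial in [e]. Its constant term belongs to
    the unperturbed direction, and its higher coefficients are the coordinates of [c], so it
    determines [c]. *)
Definition perturb_poly (c : V) : {poly R} :=
  (\sum_(i < n) (c 0 i)%:P * 'X^i) * 'X + (dot c (p - w))%:P.

Lemma horner_perturb_poly c e : (perturb_poly c).[e] = dot c (d e).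
Proof.
rewrite /perturb_poly hornerD hornerMX hornerC horner_sum mulr_suml.
rewrite /perturb addrAC [RHS]dotDr dot_sumr [LHS]addrC; congr (_ + _).
apply: eq_bigr => i _.
by rewrite dotZr dot_delta hornerM hornerC hornerXn exprSr; ring.
Qed.

Lemma perturb_poly_eq0 c : perturb_poly c = 0 -> c = 0.
Proof.
move=> c0; apply/rowP => i; rewrite mxE.
have := congr1 (fun f : {poly R} => f`_i.+1) c0.
rewrite /perturb_poly coefD coefMX coefC /= addr0 coef_sum coef0 (bigD1 i) //=.
rewrite coefCM coefXn eqxx mulr1 big1 ?addr0 // => j ji.
by rewrite coefCM coefXn eq_sym (inj_eq val_inj) (negbTE ji) mulr0.
Qed.

Lemma perturb_near_gt0 c r : 0 < dot c (p - w) + r ->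
  \forall e \near 0^'+, 0 < dot c (d e) + r.
Proof.
move=> c0; near=> e.
have -> : dot c (d e) + r = (perturb_poly c + r%:P).[e].
  by rewrite hornerD horner_perturb_poly hornerC.
near: e; apply: poly_near0_gt0.
by rewrite /perturb_poly !hornerD hornerMX !hornerC mulr0 add0r.
Unshelve. all: by end_near. Qed.

(** This is the gain from perturbing by distinct powers of [e]: no nonzero functional vanishes on
    the directions for small [e], and its sign stabilizes. *)
Lemma perturb_near_sign c : [\/ c = 0,
  \forall e \near 0^'+, 0 < dot c (d e) | \forall e \near 0^'+, dot c (d e) < 0].
Proof.
case: (poly_near0_sign (perturb_poly c)) => [/perturb_poly_eq0|c0|c0].
- by constructor 1.
- by constructor 2; near=> e; rewrite -horner_perturb_poly; near: e.
- by constructor 3; near=> e; rewrite -horner_perturb_poly; near: e.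
Unshelve. all: by end_near. Qed.

Lemma perturb_near_neq0 c : c != 0 -> \forall e \near 0^'+, dot c (d e) != 0.
Proof.
move=> /eqP c0; case: (perturb_near_sign c) => // c1; near=> e.
  by rewrite gt_eqF //; near: e.
by rewrite lt_eqF //; near: e.
Unshelve. all: by end_near. Qed.

End Perturbation.

(** * Hyperplanes and tropical hypersurfaces *)

Section Hyperplane.
Context {R : realType} {n : nat}.
Local Notation V := 'rV[R]_n.

Lemma hyperplane_normal (U : {vspace V}) : (\dim U).+1 = n ->
  exists2 a : V, a != 0 & forall x, (x \in U) = (dot a x == 0).
Proof.
move=> dimU; pose L (x : V) : 'rV[R]_(\dim U) := \row_j dot (vbasis U)`_j x.
have linL : linear L.
  by move=> t x y; apply/rowP => j; rewrite !mxE dotDr dotZr.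
pose LL : {linear V -> 'rV[R]_(\dim U)} :=
  HB.pack L (GRing.isLinear.Build _ _ _ _ L linL).
(* [L] pairs a vector with a basis of [U]. Its target has dimension [n - 1], so some nonzero vector
   is orthogonal to all of [U]. *)
have kerL : lker (linfun LL) != 0%VS.
  apply/eqP => ker0; have := limg_ker_dim (linfun LL) fullv.
  rewrite ker0 capv0 dimv0 add0n dimvf /dim /= mul1n => imL.
  have := dimvS (subvf (limg (linfun LL))); rewrite imL dimvf /dim /= mul1n.
  by rewrite -[X in (X <= _)%N]dimU ltnn.
pose a : V := vpick (lker (linfun LL)).
have a0 : a != 0 by rewrite vpick0.
have La : L a = 0.
  by have := memv_pick (lker (linfun LL)); rewrite memv_ker lfunE => /eqP.
pose f (x : V) : R^o := dot a x.
have linf : linear f by move=> t x y; rewrite /f dotDr dotZr.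
pose ff : {linear V -> R^o} := HB.pack f (GRing.isLinear.Build _ _ _ _ f linf).
have kerf x : (x \in lker (linfun ff)) = (dot a x == 0).
  by rewrite memv_ker lfunE.
exists a => // x; rewrite -kerf; suff -> : U = lker (linfun ff) by [].
(* [U] lies in the kernel of [dot a], which has dimension below [n] because [dot a a] is
   positive. *)
apply/eqP; rewrite eqEdim.
apply/andP; split.
  rewrite -(span_basis (vbasisP U)); apply/span_subvP => b.
  case/tnthP=> j ->; rewrite kerf dotC (tnth_nth 0).
  by have := congr1 (fun r : 'rV_(\dim U) => r 0 j) La; rewrite !mxE => ->.
have := limg_ker_dim (linfun ff) fullv; rewrite capfv dimvf /dim /= mul1n.
have imf : (0 < \dim (limg (linfun ff)))%N.
  rewrite lt0n dimv_eq0; apply/eqP => im0.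
  have := memv_img (linfun ff) (memvf a); rewrite im0 memv0 lfunE /= /f.
  by rewrite gt_eqF // dotxx_gt0.
by move=> En; rewrite -ltnS dimU -[X in (_ < X)%N]En
  -[X in (X < _)%N]addn0 ltn_add2l.
Qed.

Lemma lspan_sub (A : set V) : A `<=` lspan A.
Proof.
move=> x Ax; exists [:: x]; split; first by move=> y; rewrite inE => /eqP ->.
by rewrite memv_span // inE.
Qed.

Lemma codim1_normal (C : set V) : codim1 C ->
  exists2 a : V, a != 0 & lspan C = [set x | dot a x = 0].
Proof.
move=> [U [-> /hyperplane_normal[a a0 aU]]]; exists a => //.
by apply/seteqP; split=> x /=; rewrite aU => /eqP.
Qed.

Lemma hyperplane_side (a w : V) : dot a w <> 0 ->
  exists b, connected_component (~` [set x | dot a x = 0]) w = open_halfspaces [:: b].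
Proof.
(* The scalar orients the normal towards [w]: its value there becomes a square. *)
move=> aw; exists (dot a w *: a).
have aw2 : 0 < dot a w * dot a w.
  by rewrite lt_def mulf_neq0 -?expr2 ?sqr_ge0 //; apply/eqP.
apply: connected_component_halfspaces.
- by move=> b; rewrite inE => /eqP ->; rewrite dotZl.
- move=> x /(_ _ (mem_head _ _)); rewrite dotZl => + /= x0.
  by rewrite x0 mulr0 ltxx.
- move=> x /= x0 /(_ _ (mem_head _ _)) xs b; rewrite inE => /eqP ->.
  rewrite lt_def xs andbT dotZl mulf_neq0 //; exact/eqP.
Qed.

End Hyperplane.

Section TropicalHypersurface.
Context {R : realType} {n : nat}.
Local Notation V := 'rV[R]_n.

Lemma convex_hull_vertex m (v : 'I_m -> V) i : convex_hull v (v i).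
Proof.
exists (fun j => (j == i)%:R); split.
- by move=> j; rewrite ler0n.
- by rewrite (bigD1 i) //= eqxx big1 ?addr0 // => j /negbTE ->.
- rewrite (bigD1 i) //= eqxx scale1r big1 ?addr0 // => j /negbTE ->.
  by rewrite scale0r.
Qed.

(** The component is the interior of the normal cone of the vertex minimized at [w], with
    inequalities given by the differences to the other vertices. *)
Lemma tropical_complement_component (A : set V) (w : V) :
  is_tropical_hypersurface A -> ~ A w ->
  exists s, connected_component (~` A) w = open_halfspaces s.
Proof.
move=> [_ [[m [v ->]] ->]]; set P := convex_hull v => Tw.
case: (pselect (exists i0, forall i, dot w (v i0) <= dot w (v i))); last first.
  (* Without a minimizing index there are no vertices: the polytope and the hypersurface are empty,
     and the component is the whole space. *)
  move=> noi; exists [::].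
  have P0 q : ~ P q.
    case: m v @P Tw noi => [|m] v P Tw noi [c [_ c1 _]].
      by move: c1; rewrite big_ord0 => /eqP; rewrite eq_sym oner_eq0.
    apply: noi; exists [arg min_(i < ord0) dot w (v i)]%O.
    by case: Order.TotalTheory.arg_minP => // i _ imin j; exact: imin.
  apply: connected_component_halfspaces => //.
  by move=> x _ [p [q [/P0]]].
(* The filter removes repetitions of [v i0], which would impose [0 < 0]. *)
move=> [i0 wmin]; exists [seq v i - v i0 | i <- enum 'I_m & v i != v i0].
have memS a : a \in [seq v i - v i0 | i <- enum 'I_m & v i != v i0] ->
    exists2 i, v i != v i0 & a = v i - v i0.
  by case/mapP => i; rewrite mem_filter => /andP[vi _] ->; exists i.
have Smem i : v i != v i0 ->
    v i - v i0 \in [seq v i - v i0 | i <- enum 'I_m & v i != v i0].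
  by move=> vi; apply: map_f; rewrite mem_filter vi mem_enum.
have ge_hull x r : (forall i, dot x (v i0) <= dot x (v i)) -> P r ->
    dot x (v i0) <= dot x r.
  move=> xmin [c [c0 c1 ->]]; rewrite dot_sumr -[X in X <= _]mul1r -c1 mulr_suml.
  by apply: ler_sum => i _; rewrite dotZr ler_wpM2l.
have strict x : (forall i, dot x (v i0) <= dot x (v i)) ->
    ~ tropical_hypersurface P x ->
    forall i, v i != v i0 -> dot x (v i0) < dot x (v i).
  move=> xmin Tx i /eqP vi; rewrite lt_neqAle xmin andbT; apply/eqP => E.
  apply: Tx; exists (v i), (v i0); split=> //; try exact: convex_hull_vertex.
  by move=> r; apply: ge_hull.
apply: connected_component_halfspaces.
- move=> _ /memS[i vi ->]; rewrite dotBl subr_gt0 !(dotC _ w).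
  exact: strict.
- move=> x xs [p [q [Pp Pq pq xpq xq]]]; apply: pq.
  have xlt i : v i != v i0 -> dot x (v i0) < dot x (v i).
    by move=> /Smem /xs; rewrite dotBl subr_gt0 !(dotC _ x).
  (* The excess of [dot x r] over the minimum is a sum of nonnegative terms. If it vanishes, all
     weight of [r] sits on copies of [v i0]. *)
  have uniq r : P r -> dot x r <= dot x (v i0) -> r = v i0.
    move=> [c [c0 c1 ->]] xr.
    have ci_ge0 i : true -> 0 <= c i * (dot x (v i) - dot x (v i0)).
      move=> _; rewrite mulr_ge0 // subr_ge0.
      by have [->|/xlt/ltW] := eqVneq (v i) (v i0).
    have sum0 : \sum_i c i * (dot x (v i) - dot x (v i0)) = 0.
      apply/eqP; rewrite eq_le sumr_ge0 ?andbT; last by move=> i _; exact: ci_ge0.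
      move: xr; rewrite dot_sumr -[X in _ <= X]mul1r -c1 mulr_suml -subr_le0 -sumrB.
      by under eq_bigr do rewrite dotZr -mulrBr.
    rewrite -[RHS]scale1r -c1 scaler_suml; apply: eq_bigr => i _.
    have [-> //|vi] := eqVneq (v i) (v i0).
    have /eqP := psumr_eq0P ci_ge0 sum0 (i := i) isT.
    rewrite mulf_eq0 subr_eq0 => /orP[/eqP ->|]; first by rewrite !scale0r.
    by rewrite gt_eqF ?xlt.
  have xq0 : dot x q <= dot x (v i0) by apply: xq; exact: convex_hull_vertex.
  by rewrite (uniq p) ?xpq // (uniq q).
- move=> x Tx xge _ /memS[i vi ->]; rewrite dotBl subr_gt0 !(dotC _ x).
  apply: strict => // j; have [-> //|/Smem/xge] := eqVneq (v j) (v i0).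
  by rewrite dotBl subr_ge0 !(dotC _ x).
Qed.

End TropicalHypersurface.

(** * The procedure *)

Section Procedure.
Context {R : realType} {n : nat}.
Local Notation V := 'rV[R]_n.
Variables (S : seq (set V)) (w : V).
Hypothesis coneS : forall C, C \in S -> polyhedral_cone C /\ codim1 C.
Hypothesis wT : ~ cone_union S w.
Local Notation T := (cone_union S).

Lemma sub_cone_union C : C \in S -> C `<=` T.
Proof. by move=> CS x Cx; exists C. Qed.

Lemma hit_param_gt0 t (x : V) : T (w + t *: x) -> 0 <= t -> 0 < t.
Proof.
move=> Tx; rewrite le_eqVlt => /predU1P[t0|//]; exfalso; apply: wT.
by rewrite -t0 scale0r addr0 in Tx.
Qed.

Lemma edist_ray t (x : V) : 0 <= t ->
  edist w (w + t *: x) = t * Num.sqrt (dot x x).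
Proof.
move=> t0; rewrite /edist opprD addNKr -scaleNr dotZl dotZr mulrA mulrNN.
by rewrite sqrtrM ?mulr_ge0 // -expr2 sqrtr_sqr ger0_norm.
Qed.

(** Distance to [w] along the ray is the parameter times a fixed length, which is positive because a
    hit with [x = w] would put [w] in [T]. *)
Lemma closest_on_first x D : D \in S -> closest_on S w (half_line w x) D ->
  exists t, [/\ 0 < t, D (w + t *: (x - w)) &
    forall C t', C \in S -> 0 < t' -> C (w + t' *: (x - w)) -> t <= t'].
Proof.
move=> DS [q [Dq qmin]]; have [Dq' [t /= t0 tq]] : (D `&` half_line w x) q.
  by rewrite Dq.
exists t; split=> // [|C t' CS t'0 Ct']; first by rewrite tq.
have := qmin C (w + t' *: (x - w)) CS.
have Ch : (C `&` half_line w x) (w + t' *: (x - w)) by split=> //; exists t'.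
move=> /(_ Ch); rewrite -tq !edist_ray ?(ltW t0) ?(ltW t'0) //.
rewrite ler_pM2r // sqrtr_gt0 dotxx_gt0 //; apply/eqP => xw.
by apply: wT; exists D => //; rewrite -tq xw scaler0 addr0 in Dq'.
Qed.

(** * Cones met by the perturbed rays *)

Section Perturbed.
Variable p : V.
Local Notation d e := (perturb p e - w).

(* A normal of the span is scaled so that [dot a w = - 1]: the ray then meets the
   span at parameter [t] exactly when [t * dot a (d e) = 1], and all conditions
   for hitting D become signs of linear functionals of [d e]. *)
Lemma cone_normal_form D : polyhedral_cone D -> codim1 D ->
  (exists2 a : V, a != 0 & lspan D = [set x | dot a x = 0] /\ dot a w = 0) \/
  exists (a : V) m (b : 'I_m -> V),
    [/\ dot a w = -1, lspan D = [set x | dot a x = 0] &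
        D = [set x | forall i, 0 <= dot (b i) x]].
Proof.
move=> [m [b Db]] /codim1_normal[a a0 Da].
have [aw|aw] := eqVneq (dot a w) 0; first by left; exists a.
right; exists (- (dot a w)^-1 *: a), m, b; split=> //.
  by rewrite dotZl mulNr mulVf.
rewrite Da; apply/seteqP; split=> x /=; rewrite dotZl; first by move=> ->; rewrite mulr0.
by move/eqP; rewrite mulf_eq0 oppr_eq0 invr_eq0 (negbTE aw) => /eqP.
Qed.

Lemma cone_hit D : polyhedral_cone D -> codim1 D ->
  (\forall e \near 0^'+, forall t, 0 < t -> ~ D (w + t *: d e)) \/
  exists a : V, \forall e \near 0^'+, 0 < dot a (d e) /\
    forall t, 0 < t -> D (w + t *: d e) <-> t * dot a (d e) = 1.
Proof.
move=> pD cD; have [[a a0 [Da aw]]|[a [m [b [aw Da Db]]]]] := cone_normal_form pD cD.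
  (* A span through [w] is met by the ray at no positive parameter, since [dot a (d e)] is
     nonzero. *)
  left; have ne0 := @perturb_near_neq0 _ _ w p _ a0; near=> e => t t0 Dt.
  have ade : dot a (d e) != 0 by near: e.
  have /= : (lspan D) (w + t *: d e) by exact: lspan_sub.
  rewrite Da /= dotDr aw add0r dotZr => /eqP.
  by rewrite mulf_eq0 (gt_eqF t0) (negbTE ade).
have spanE t e : D (w + t *: d e) -> t * dot a (d e) = 1.
  move/lspan_sub; rewrite Da /= dotDr aw dotZr => /eqP.
  by rewrite addrC subr_eq0 => /eqP.
have [a0|apos|aneg] := perturb_near_sign w p a.
- by move: aw; rewrite a0 dot0l => /eqP; rewrite eq_sym oppr_eq0 oner_eq0.
(* On the span [t * dot a (d e) = 1], so the constant [dot (b i) w] can be absorbed: [c i] makes the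
   inequality homogeneous in [d e]. *)
- pose c i := b i + dot (b i) w *: a.
  have cE t e i : t * dot a (d e) = 1 ->
      dot (b i) (w + t *: d e) = t * dot (c i) (d e).
    by move=> ta; rewrite dotDr dotZr dotDl dotZl mulrDr mulrCA ta mulr1 addrC.
  have [cpos|] :=
    pselect (forall i, \forall e \near 0^'+, 0 <= dot (c i) (d e)).
    right; exists a; near=> e; split; first by near: e.
    have ce : forall i, 0 <= dot (c i) (d e) by near: e; exact: filter_forall.
    move=> t t0; split; first exact: spanE.
    by move=> ta; rewrite Db => i; rewrite cE // mulr_ge0 // ltW.
  move=> /existsNP[i ci]; left.
  have cneg : \forall e \near 0^'+, dot (c i) (d e) < 0.
    case: (perturb_near_sign w p (c i)) => // c0; case: ci.
      by near=> e; rewrite c0 dot0l.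
    by near=> e; apply: ltW; near: e.
  near=> e => t t0 Dt; have ta := spanE _ _ Dt.
  move: Dt; rewrite Db => /(_ i); rewrite cE // pmulr_rge0 // leNgt.
  by apply/negP; rewrite negbK; near: e.
- left; near=> e => t t0 /spanE ta.
  have : t * dot a (d e) < 0 by rewrite pmulr_rlt0 //; near: e.
  by rewrite ta ltr10.
Unshelve. all: by end_near. Qed.

(* The perturbed ray avoids every proper face of D, so it only meets D in its
   relative interior. *)
Lemma cone_hit_relative_interior D : polyhedral_cone D -> codim1 D ->
  \forall e \near 0^'+, forall t, 0 < t -> D (w + t *: d e) ->
    ~ lspan D w /\ forall x, lspan D x ->
      \forall s \near 0^'+, D (w + t *: d e + s *: (x - (w + t *: d e))).
Proof.
move=> pD cD; have [[a a0 [Da aw]]|[a [m [b [aw Da Db]]]]] := cone_normal_form pD cD.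
  have ne0 := @perturb_near_neq0 _ _ w p _ a0; near=> e => t t0 Dt.
  have ade : dot a (d e) != 0 by near: e.
  have /= : (lspan D) (w + t *: d e) by exact: lspan_sub.
  rewrite Da /= dotDr aw add0r dotZr => /eqP.
  by rewrite mulf_eq0 (gt_eqF t0) (negbTE ade).
pose c i := b i + dot (b i) w *: a.
have cne i : \forall e \near 0^'+, c i != 0 -> dot (c i) (d e) != 0.
  have [->|ci] := eqVneq (c i) 0; first by near=> e.
  by have := @perturb_near_neq0 _ _ w p _ ci; apply: filterS.
near=> e => t t0 Dt.
have ce : forall i, c i != 0 -> dot (c i) (d e) != 0 by near: e; exact: filter_forall.
have ta : t * dot a (d e) = 1.
  move/lspan_sub: Dt; rewrite Da /= dotDr aw dotZr => /eqP.
  by rewrite addrC subr_eq0 => /eqP.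
split=> [|x]; rewrite Da /=.
  by rewrite aw => /eqP; rewrite oppr_eq0 oner_eq0.
move=> ax; set q := w + t *: d e.
have cE i : dot (b i) q = t * dot (c i) (d e).
  by rewrite /q dotDr dotZr dotDl dotZl mulrDr mulrCA ta mulr1 addrC.
have bnear i : \forall s \near 0^'+, 0 <= dot (b i) (q + s *: (x - q)).
  (* If [c i = 0] then [b i] is a multiple of [a] and vanishes on the span. Otherwise its inequality
     is strict at [q] and survives a small move. *)
  have [ci|ci] := eqVneq (c i) 0.
    near=> s; rewrite dot_segment cE ci dot0l !mulr0 add0r.
    move/(congr1 (dot^~ x)): ci; rewrite dot0l dotDl dotZl ax mulr0 addr0 => ->.
    by rewrite mulr0.
  have bq : 0 < dot (b i) q.
    rewrite lt_def cE mulf_neq0 ?(gt_eqF t0) ?ce //= -cE.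
    by move: Dt; rewrite Db; exact.
  near=> s; apply: ltW.
  have -> : dot (b i) (q + s *: (x - q)) =
      ((dot (b i) (x - q))%:P * 'X + (dot (b i) q)%:P).[s].
    by rewrite dotDr dotZr hornerD hornerMX !hornerC mulrC addrC.
  near: s; apply: poly_near0_gt0.
  by rewrite hornerD hornerMX !hornerC mulr0 add0r.
by near=> s; rewrite Db /=; near: s; exact: filter_forall.
Unshelve. all: by end_near. Qed.

(* [dot a (d e)] is the inverse of the hitting time, so the first cone is the
   one whose functional a is eventually largest. *)
Lemma eventually_first (s : seq (set V)) : {subset s <= S} ->
  (forall C, C \in s -> \forall e \near 0^'+, forall t, 0 < t -> ~ C (w + t *: d e)) \/
  exists D (a : V), [/\ D \in s,
    \forall e \near 0^'+, 0 < dot a (d e) /\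
      (forall t, 0 < t -> D (w + t *: d e) <-> t * dot a (d e) = 1) &
    forall C, C \in s -> \forall e \near 0^'+, forall t, 0 < t ->
      C (w + t *: d e) -> 1 <= t * dot a (d e)].
Proof.
elim: s => [|C s IH] sS; first by left.
have CS : C \in S by apply: sS; rewrite inE eqxx.
have {}IH := IH (fun D Ds => sS D (mem_behead (s := C :: s) Ds)).
have [pC cC] := coneS CS.
have [Cno|[a Ca]] := cone_hit pC cC.
  case: IH => [sno|[D [a [Ds Da amin]]]].
    by left=> D; rewrite inE => /orP[/eqP ->|/sno].
  right; exists D, a; split=> //; first by rewrite inE Ds orbT.
  move=> E; rewrite inE => /orP[/eqP ->|/amin//].
  by apply: filterS Cno => e eno t t0 /(eno t t0).
have Cmin (b : V) : (\forall e \near 0^'+, dot a (d e) <= dot b (d e)) ->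
    \forall e \near 0^'+, forall t, 0 < t -> C (w + t *: d e) -> 1 <= t * dot b (d e).
  move=> ab; near=> e => t t0 Ct.
  have [_ /(_ t t0)[/(_ Ct) <- _]] : 0 < dot a (d e) /\
      forall t, 0 < t -> C (w + t *: d e) <-> t * dot a (d e) = 1 by near: e.
  by rewrite ler_pM2l //; near: e.
right; case: IH => [sno|[D [b [Ds Db bmin]]]].
  exists C, a; split=> //; first by rewrite inE eqxx.
  move=> E; rewrite inE => /orP[/eqP ->|/sno Eno].
    by apply: Cmin; near=> e.
  by apply: filterS Eno => e eno t t0 /(eno t t0).
(* The sign of [b - a] stabilizes, so the order of the two hits is the same for all small [e]. *)
have [ab|ba] : (\forall e \near 0^'+, dot a (d e) <= dot b (d e)) \/
    (\forall e \near 0^'+, dot b (d e) <= dot a (d e)).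
  case: (perturb_near_sign w p (b - a)) => ba; [left|left|right].
  - by near=> e; rewrite -subr_ge0 -dotBl ba dot0l.
  - by near=> e; rewrite -subr_ge0 -dotBl; apply: ltW; near: e.
  - by near=> e; rewrite -subr_le0 -dotBl; apply: ltW; near: e.
- exists D, b; split=> //; first by rewrite inE Ds orbT.
  by move=> E; rewrite inE => /orP[/eqP ->|/bmin//]; exact: Cmin.
- exists C, a; split=> //; first by rewrite inE eqxx.
  move=> E; rewrite inE => /orP[/eqP ->|/bmin Emin].
    by apply: Cmin; near=> e.
  near=> e => t t0 Et; apply: (@le_trans _ _ (t * dot b (d e))).
    by move: t t0 Et; near: e.
  by rewrite ler_pM2l //; near: e.
Unshelve. all: by end_near. Qed.

(** Hits for small [e] exclude that every cone is eventually missed. A single cone is then first for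
    all small [e], at the inverse of its functional. *)
Lemma selectable_of_hit :
  (\forall e \near 0^'+, exists2 t, 0 < t & T (w + t *: d e)) ->
  exists D, selectable S w p D.
Proof.
move=> hit; have [no|[D [a [DS Da amin]]]] := @eventually_first S (fun _ => id).
  exfalso.
  have [e [_ [t t0 [C CS Ct]] /(_ C CS t t0)]] :=
    near_right0_ex2 hit (near_seq_forall no).
  exact.
exists D; split=> //.
near=> e.
have [a0 DE] : 0 < dot a (d e) /\
  (forall t, 0 < t -> D (w + t *: d e) <-> t * dot a (d e) = 1) by near: e.
have aV : 0 < (dot a (d e))^-1 by rewrite invr_gt0.
exists (w + (dot a (d e))^-1 *: d e); split.
  apply/seteqP; split=> [_ [/[swap] [[t /= t0 <-]]]|_ ->] /=.
    move=> /(DE _ t0) ta; congr (_ + _ *: _).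
    by rewrite -[LHS](mulfK (lt0r_neq0 a0)) ta div1r.
  split; last by exists (dot a (d e))^-1.
  by apply/(DE _ aV); rewrite mulVf // lt0r_neq0.
move=> C _ CS [/[swap] [[t /= t0 <-]]] Ct; rewrite !edist_ray ?(ltW aV) ?(ltW t0) //.
rewrite ler_wpM2r ?sqrtr_ge0 // -div1r ler_pdivrMr //.
by move: C CS t t0 Ct; near: e; exact: near_seq_forall.
Unshelve. all: by end_near. Qed.

(** * The first hit and the component of [w] *)

Variable k : seq V.
Hypothesis hK : connected_component (~` T) w = open_halfspaces k.

Lemma component_w : open_halfspaces k w.
Proof. by rewrite -hK; apply: connected_component_refl. Qed.

(* The ray enters the open half space where some inequality defining the
   component fails at p, and it does so right after parameter 1. *)
Lemma ray_leaves_component s : open_halfspaces s w -> open_halfspaces s p -> T p ->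
  exists t0, \forall e \near 0^'+,
    (exists t, [/\ 0 < t, t <= t0 & T (w + t *: d e)]) /\
    forall t, 0 <= t <= t0 -> open_halfspaces s (w + t *: d e).
Proof.
move=> ws ps Tp.
have [u u0 us] : exists2 u, 0 < u & forall a, a \in s -> 0 < dot a (p + u *: (p - w)).
  suff su : \forall u \near 0^'+, forall a, a \in s -> 0 < dot a (p + u *: (p - w)).
    by have [u [u0 us _]] := near_right0_ex2 su su; exists u.
  apply: near_seq_forall => a sa; near=> u.
  have -> : dot a (p + u *: (p - w)) =
      ((dot a (p - w))%:P * 'X + (dot a p)%:P).[u].
    by rewrite dotDr dotZr hornerD hornerMX !hornerC mulrC addrC.
  near: u; apply: poly_near0_gt0.
  by rewrite hornerD hornerMX !hornerC mulr0 add0r; exact: ps.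
have [b bk bp] : exists2 b, b \in k & dot b p <= 0.
  apply: contrapT => nb; have : open_halfspaces k p.
    by move=> b bk; rewrite ltNge; apply/negP => bp; apply: nb; exists b.
  by rewrite -hK => /connected_component_sub.
have bw := component_w bk.
(* This is the parameter of [p + u *: (p - w)] on the unperturbed ray: still inside [s], but already
   strictly negative for [b]. *)
pose t0 := 1 + u; have t00 : 0 < t0 by rewrite addr_gt0.
exists t0.
have sz : \forall e \near 0^'+, forall a, a \in s -> 0 < dot a (w + t0 *: d e).
  apply: near_seq_forall => a sa; near=> e.
  rewrite dotDr dotZr addrC -dotZl; near: e; apply: perturb_near_gt0.
  have := us a sa; rewrite dotZl !dotBr dotDr dotZr dotBr /t0; lra.
have kz : \forall e \near 0^'+, dot b (w + t0 *: d e) < 0.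
  near=> e; rewrite -oppr_gt0 dotDr dotZr opprD addrC -mulNr -dotZl.
  near: e; apply: perturb_near_gt0; rewrite dotZl dotBr /t0; nra.
near=> e.
have sze : open_halfspaces s (w + t0 *: d e) by near: e.
have kze : dot b (w + t0 *: d e) < 0 by near: e.
have onseg t : w + t *: d e = w + (t / t0) *: (w + t0 *: d e - w).
  by rewrite (addrC w (t0 *: _)) addrK scalerA divfK // gt_eqF.
split; last first.
  move=> t /andP[t_ge0 tt0]; rewrite onseg; apply: open_halfspaces_segment => //.
  by rewrite divr_ge0 ?(ltW t00) //= ler_pdivrMr // mul1r.
(* A segment from [w] that avoids [T] would end in the component, against the negative value of
   [b]. *)
apply: contrapT => noT; have : open_halfspaces k (w + t0 *: d e).
  rewrite -hK; apply: segment_connected_component => r /andP[r0 r1].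
  rewrite (addrC w (t0 *: _)) addrK scalerA => Tr; apply: noT; exists (r * t0).
  have rt0 : 0 <= r * t0 by rewrite mulr_ge0 // ltW.
  split=> //; first exact: hit_param_gt0 Tr rt0.
  by rewrite -[X in _ <= X]mul1r ler_pM2r.
by move/(_ b bk); rewrite ltNge ltW.
Unshelve. all: by end_near. Qed.

Lemma selectable_separates D : selectable S w p D ->
  ~ lspan D w /\ forall x, open_halfspaces k x -> ~ lspan D x.
Proof.
move=> [DS Dsel]; have [pD cD] := coneS DS.
have [e [_ /(closest_on_first DS)[t [t0 Dt tmin]]]] :=
  near_right0_ex2 Dsel (cone_hit_relative_interior pD cD).
move=> /(_ t t0 Dt)[wD Dint]; split=> // x kx /Dint {}Dint.
set q := w + t *: d e in Dt Dint.
(* No cone is hit before [q], so the segment from [w] stays in the component up to [q]. *)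
have kseg s : 0 <= s < 1 -> open_halfspaces k (w + s *: (q - w)).
  move=> /andP[s0 s1]; rewrite -hK; apply: segment_connected_component => r.
  move=> /andP[r0 r1]; rewrite /q (addrC w (s *: _)) addrK (addrC w (t *: _)) addrK.
  rewrite !scalerA => Tr.
  have rs : 0 < r * s * t by apply: hit_param_gt0 Tr _; rewrite !mulr_ge0 // ltW.
  have [C CS Cr] := Tr; have := tmin C _ CS rs Cr.
  by rewrite leNgt -[X in _ < X]mul1r ltr_pM2r // (le_lt_trans _ s1) // ler_piMl.
have kq a : a \in k -> 0 <= dot a q.
  move=> ak; rewrite leNgt; apply/negP => aq; have aw := component_w ak.
  have awq : 0 < dot a w - dot a q by rewrite subr_gt0 (lt_trans aq).
  (* At this parameter [dot a] would vanish, before [q] is reached. *)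
  have /kseg/(_ a ak) : 0 <= dot a w / (dot a w - dot a q) < 1.
    by rewrite divr_ge0 ?ltW //= ltr_pdivrMr // mul1r ltrDl oppr_gt0.
  rewrite dotDr dotZr dotBr -[dot a q - _]opprB mulrN divfK ?gt_eqF //.
  by rewrite subrr ltxx.
have [s [s0 Ds s1]] := near_right0_ex2 Dint (nbhs_right_lt ltr01).
have : open_halfspaces k (q + s *: (x - q)).
  move=> a ak; rewrite dot_segment; have := kq a ak; have := kx a ak.
  by move=> ax aq; rewrite ltr_wpDl ?mulr_gt0 // mulr_ge0 // subr_ge0 ltW.
by rewrite -hK => /connected_component_sub; apply; exact: sub_cone_union Ds.
Qed.

Lemma selectable_exists s : open_halfspaces s w -> open_halfspaces s p -> T p ->
  exists D, selectable S w p D.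
Proof.
move=> ws ps Tp; have [t0 near_t0] := ray_leaves_component ws ps Tp.
apply: selectable_of_hit; apply: filterS near_t0 => e [[t [t_gt0 _ Tt]] _].
by exists t.
Qed.

(** The ray hits [T] while still inside the polyhedron, so the first hit, a point of [D], is inside
    too. This makes each cut count as progress. *)
Lemma selectable_meets s D : open_halfspaces s w -> open_halfspaces s p -> T p ->
  selectable S w p D -> (open_halfspaces s `&` lspan D) !=set0.
Proof.
move=> ws ps Tp [DS Dsel]; have [t0 near_t0] := ray_leaves_component ws ps Tp.
have [e [_ /(closest_on_first DS)[t [t_gt0 Dt tmin]]]] :=
  near_right0_ex2 Dsel near_t0.
move=> [[t1 [t1_gt0 t10 [C CS Ct1]]] seg]; exists (w + t *: d e); split.
  by apply: seg; rewrite ltW //= (le_trans _ t10) // (tmin C).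
exact: lspan_sub.
Qed.

End Perturbed.

(** * Invariant, termination and output *)

Variable k : seq V.
Hypothesis hK : connected_component (~` T) w = open_halfspaces k.

Definition region_inv (rest : seq (set V)) (Q : set V) : Prop :=
  [/\ exists s, Q = open_halfspaces s, open_halfspaces k `<=` Q,
      {subset rest <= S}
    & forall C, C \in S -> C \in rest \/ Q `&` C = set0].

(** For a selected cone, the span meeting [Q] makes the cut effective, and the span missing the
    component makes it harmless. *)
Definition state_inv (c : state) : Prop :=
  match c with
  | AtTest rest Q => region_inv rest Q
  | PointFound rest Q p => [/\ region_inv rest Q, Q p & T p]
  | ConeSelected rest Q D => [/\ region_inv rest Q, D \in S,
      (Q `&` lspan D) !=set0 & forall x, open_halfspaces k x -> ~ lspan D x]
  end.

Definition spans_met (Q : set V) : nat :=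
  count (fun D => `[< (Q `&` lspan D) !=set0 >]) S.

(** The offsets 2, 1, 0 fall along the transitions of one iteration. A cut returns to offset 2 but
    loses at least one span, hence the weight 3. *)
Definition state_measure (c : state) : nat :=
  match c with
  | AtTest rest Q => 3 * spans_met Q + size rest + 2
  | PointFound rest Q _ => 3 * spans_met Q + size rest + 1
  | ConeSelected rest Q _ => 3 * spans_met Q + size rest
  end.

Lemma ltn_count (U : eqType) (a b : pred U) (s : seq U) x :
  subpred a b -> x \in s -> b x -> ~~ a x -> (count a s < count b s)%N.
Proof.
move=> ab + bx ax; elim: s => //= y s IH; rewrite inE => /orP[/eqP <-|/IH lt].
  by rewrite bx (negbTE ax) add0n add1n ltnS sub_count.
rewrite -addnS leq_add //.
by have := ab y; case: (a y) => // ->.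
Qed.

Lemma state_inv_step c c' : state_inv c -> step S w c c' ->
  state_inv c' /\ (state_measure c' < state_measure c)%N.
Proof.
move=> + cc'.
case: cc' => [C rest Q QC|C rest Q p [Qp Cp]|rest Q p D Dsel|rest Q D wD] /=.
- move=> [Qs kQ restS Qdone]; split; last by lia.
  split=> // [E Er|E /Qdone]; first by apply: restS; rewrite inE Er orbT.
  by rewrite inE => -[/orP[/eqP ->|]|]; auto.
- move=> Qinv; split; last by lia.
  split=> //; have [_ _ restS _] := Qinv; apply: sub_cone_union Cp.
  by apply: restS; rewrite inE eqxx.
- move=> [Qinv Qp Tp]; split; last by lia.
  have [wD kD] := selectable_separates hK Dsel.
  have [[s Qs] kQ _ _] := Qinv; have [DS _] := Dsel.
  split=> //; rewrite Qs in Qp kQ *.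
  refine (selectable_meets hK (kQ _ (component_w hK)) Qp Tp Dsel).
- move=> [[[s ->] kQ restS Qdone] DS QD kD]; set H := connected_component _ _.
  have HD x : H x -> ~ lspan D x by move/connected_component_sub.
  split; last first.
    suff : (spans_met (open_halfspaces s `&` H) < spans_met (open_halfspaces s))%N.
      by lia.
    apply: (@ltn_count _ _ _ _ D) => //; last 2 first.
    + exact/asboolP.
    + by apply/asboolP => -[x [[_ /HD]]].
    by move=> E /asboolP[x [[xs _] xE]]; apply/asboolP; exists x.
  split=> //.
  + have [a _ Da] := codim1_normal (coneS DS).2.
    have aw : dot a w <> 0 by move=> aw; apply: wD; rewrite Da.
    have [b Hb] := hyperplane_side aw.
    by exists (s ++ [:: b]); rewrite open_halfspaces_cat /H Da Hb.
  (* The component is convex, contains [w] and misses the span, so it lies on the side of [w]. *)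
  + move=> x kx; split; first exact: kQ.
    rewrite /H; have kw := component_w hK.
    apply: segment_connected_component => t t01; apply: kD.
    exact: open_halfspaces_segment.
  + move=> C /Qdone[|QC]; [by left|right].
    by rewrite setIAC QC set0I.
Qed.

Lemma Acc_state_inv c : state_inv c -> Acc (fun c' c => step S w c c') c.
Proof.
move: {2}_.+1 (ltnSn (state_measure c)) => m.
elim: m c => [|m IH] c; first by rewrite ltn0.
rewrite ltnS => cm cinv; constructor=> c' cc'.
have [c'inv lt] := state_inv_step cinv cc'.
by apply: IH c'inv; exact: leq_trans lt cm.
Qed.

Lemma state_inv_progress c : state_inv c ->
  (exists c', step S w c c') \/ exists Q, c = AtTest [::] Q.
Proof.
case: c => [[|C rest] Q|rest Q p|rest Q D] /=.
- by right; exists Q.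
- left; have [QC|/set0P[p pQC]] := eqVneq (Q `&` C) set0.
    by exists (AtTest rest Q); constructor.
  by exists (PointFound (C :: rest) Q p); constructor.
- move=> [[[s ->] kQ _ _] Qp Tp]; left.
  have [D Dsel] := selectable_exists hK (kQ _ (component_w hK)) Qp Tp.
  by exists (ConeSelected rest (open_halfspaces s) D); apply: step_select Dsel.
- move=> [_ _ _ kD]; left.
  exists (AtTest rest (Q `&` connected_component (~` lspan D) w)).
  by constructor; apply: kD; exact: component_w.
Qed.

Lemma reachable_state_inv c : reachable S w c -> state_inv c.
Proof.
have : state_inv (initial S).
  split=> //; [by exists [::]; apply/seteqP; split|by move=> C ->; left].
rewrite /reachable; move: (initial S) => c0 c0inv c0c; move: c0inv.
elim: c0c => // x y z xy _ IH xinv; apply: IH.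
by have [] := state_inv_step xinv xy.
Qed.

Lemma state_inv_final Q : state_inv (AtTest [::] Q) -> Q = open_halfspaces k.
Proof.
move=> [[s Qs] kQ _ Qdone]; apply/seteqP; split=> // x Qx.
(* No cone is pending, so all are disjoint from the convex [Q], and segments from [w] inside [Q]
   avoid [T]. *)
rewrite -hK; apply: segment_connected_component => t t01 [C CS Ct].
have [//|QC] := Qdone C CS; suff : (Q `&` C) (w + t *: (x - w)) by rewrite QC.
split=> //; rewrite Qs in Qx kQ *; apply: open_halfspaces_segment => //.
by apply: kQ; exact: component_w.
Qed.

End Procedure.

Theorem mainTheorem6 (R : realType) (n : nat) (S : seq (set 'rV[R]_n))
    (w : 'rV[R]_n)
    (hS : forall C, C \in S -> polyhedral_cone C /\ codim1 C)
    (hT : is_tropical_hypersurface (cone_union S))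
    (hw : ~ cone_union S w) :
  open (connected_component (~` cone_union S) w) /\
  region_outputs S w (connected_component (~` cone_union S) w).
Proof.
have [k hK] := tropical_complement_component hT hw.
have reach_inv := reachable_state_inv hS hw hK.
split; first by rewrite hK; exact: open_open_halfspaces.
split.
- by apply: (Acc_state_inv hS hw hK); apply: reach_inv; constructor.
- by move=> c /reach_inv; exact: state_inv_progress.
- by move=> Q /reach_inv /(state_inv_final hw hK) ->; rewrite hK.
Qed.
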